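(* Let $k\geq 2$ be an integer. If $T$ is an MTP tiling of the unit square with exactly $k^2+3$ tiles and $\sigma(T)>k+\frac1k$, then the tiles of $T$ have at least three distinct side lengths, and $T$ has a unique smallest tile (i.e. exactly one tile of $T$ has the minimal side length).
   Context: A tiling $T$ of the unit square (by squares) is a finite collection of squares (''tiles'') of positive side lengths $s_1,\ldots,s_n$ with pairwise disjoint interiors whose union is the unit square. The length of the tiling is $\sigma(T)=\sum_{i=1}^n s_i$. A tiling $T$ has the Minimal Tile Property (MTP), and is called an MTP tiling, if every tile in $T$ can be tiled by copies of the smallest tile of $T$, i.e. every side length $s_i$ is a positive integer multiple of the smallest side length occurring in $T$. *)

(* Defs.v *)
From HB Require Import structures.
From mathcomp Require Import all_boot all_order all_algebra.
From mathcomp Require Import all_classical all_reals all_analysis.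

Set Implicit Arguments.
Unset Strict Implicit.
Unset Printing Implicit Defensive.

Import Order.TTheory GRing.Theory Num.Theory.
Import numFieldNormedType.Exports.

Local Open Scope classical_set_scope.
Local Open Scope ring_scope.

(* Squares of arbitrary position and orientation: a corner, the unit vector
   directing an edge out of that corner, and the side length.  The square lies
   to the left of that edge, which is no restriction since every square has
   such an edge at each of its corners. *)
Record square (R : realType) := Square {
  corner : R * R;
  dir : R * R;
  side : R;
  dir_unit : dir.1 ^+ 2 + dir.2 ^+ 2 = 1;
  side_gt0 : 0 < side }.

Definition square_set (R : realType) (Q : square R) : set (R * R) :=
  [set ((corner Q).1 + a * (dir Q).1 - b * (dir Q).2,
        (corner Q).2 + a * (dir Q).2 + b * (dir Q).1)
     | a in `[0, side Q] & b in `[0, side Q]].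

Definition unit_square (R : realType) : set (R * R) := `[0, 1] `*` `[0, 1].
Arguments unit_square R : clear implicits.

(* The interiors are topological ones, in the plane R * R.  Since squares have
   nonempty interior, the tiles of a tiling are distinct, so that the
   collection has exactly n members. *)
Definition is_tiling (R : realType) (n : nat) (T : 'I_n -> square R) : Prop :=
  (forall i j : 'I_n, i != j ->
     interior (square_set (T i)) `&` interior (square_set (T j)) = set0) /\
  \bigcup_(i in [set: 'I_n]) square_set (T i) = unit_square R.

Definition tiling_length (R : realType) (n : nat) (T : 'I_n -> square R) : R :=
  \sum_(i < n) side (T i).

Definition smallest_tile (R : realType) (n : nat) (T : 'I_n -> square R)
    (i : 'I_n) : Prop :=
  forall j : 'I_n, side (T i) <= side (T j).

Definition MTP (R : realType) (n : nat) (T : 'I_n -> square R) : Prop :=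
  forall i j : 'I_n, smallest_tile T i ->
    exists2 m : nat, (0 < m)%N & side (T j) = m%:R * side (T i).

Definition side_lengths (R : realType) (n : nat) (T : 'I_n -> square R) :
    seq R :=
  undup [seq side (T i) | i : 'I_n].

(* Main.v *)
Require Import Defs.
From HB Require Import structures.
From mathcomp Require Import all_boot all_order all_algebra.
From mathcomp Require Import all_classical all_reals all_analysis.
From mathcomp Require Import zify ring lra.

Import Order.TTheory GRing.Theory Num.Theory.
Import numFieldNormedType.Exports.

Local Open Scope classical_set_scope.
Local Open Scope ring_scope.

(** Everything reduces to an identity between integers.  Measure lengths in
    units of the smallest side: the tiles have integer sides m_l, and, once they
    are known to be parallel to the axes, a horizontal line meeting no
    horizontal edge of a tile is cut into tile sides, so the big square has an
    integer side N.  Comparing areas gives sum m_l^2 = N^2, and the hypothesis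
    on the length reads N(k^2+1) < k sum m_l.

    Uniqueness of the smallest tile is then pure arithmetic
    ([two_units_short]).  Write N = tk + r with 1 <= r <= k.  Each
    (m_l - t)(m_l - t - 1) is nonnegative, and it is t(t-1) when m_l = 1, so two
    unit tiles give sum_l (m_l - t)(m_l - t - 1) >= 2t(t-1).  Expanding the sum
    with the values of sum m_l^2 and of the number k^2+3 of tiles, this bounds
    sum m_l from above, and the bound contradicts the length hypothesis once
    that one is rounded to the next integer.

    Let now the smallest tile be unique, and suppose that all other tiles have
    the same side a > 1.  The smallest tile does not reach both the bottom and
    the top of the big square, so some horizontal line avoids it
    ([upright_line_missing]) and a divides N.  But N^2 is 1 plus a multiple of
    a^2, which forces a = 1.

    That every tile is parallel to the axes ([tiles_axis_parallel]) is seen at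
    the lowest corner v of a lowest tilted tile Q: the thin wedge at v between
    the horizontal and the lower edge of Q must be covered by another tile
    containing v.  If that tile is upright it contains a quadrant at v, and if
    it is tilted then v is its lowest corner too; both ways it overlaps Q.
    Areas and lengths are computed with Lebesgue measure
    ([measure_almost_partition]). *)

(** * Frames *)

(** A square seen from its corner (x, y) and the direction (c, d) of an edge
    out of it, the corner being chosen such that the direction makes an angle in
    [0, 90) degrees with the horizontal.  Then the square is upright exactly
    when d = 0, and (x, y) is its lowest point, the only one if d > 0. *)
Record is_frame {R : realType} (S : set (R * R)) (s x y c d : R) : Prop :=
  IsFrame {
    frame_c : 0 < c;
    frame_d : 0 <= d;
    frame_unit : c ^+ 2 + d ^+ 2 = 1;
    frame_mem : forall p, S p <->
      0 <= (p.1 - x) * c + (p.2 - y) * d <= s /\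
      0 <= (p.2 - y) * c - (p.1 - x) * d <= s }.

Arguments frame_c {R S s x y c d}.
Arguments frame_d {R S s x y c d}.
Arguments frame_unit {R S s x y c d}.
Arguments frame_mem {R S s x y c d}.

Lemma square_set_coords {R : realType} (Q : square R) p :
  square_set Q p <->
  0 <= (p.1 - (corner Q).1) * (dir Q).1 + (p.2 - (corner Q).2) * (dir Q).2
    <= side Q /\
  0 <= (p.2 - (corner Q).2) * (dir Q).1 - (p.1 - (corner Q).1) * (dir Q).2
    <= side Q.
Proof.
case: Q => -[x y] [c d] s /= u s0; split.
  case=> a; rewrite /= in_itv /= => ha [b]; rewrite /= in_itv /= => hb <- /=.
  have -> : (x + a * c - b * d - x) * c + (y + a * d + b * c - y) * d
            = a * (c ^+ 2 + d ^+ 2) by ring.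
  have -> : (y + a * d + b * c - y) * c - (x + a * c - b * d - x) * d
            = b * (c ^+ 2 + d ^+ 2) by ring.
  by rewrite u !mulr1.
case=> ha hb.
exists ((p.1 - x) * c + (p.2 - y) * d); first by rewrite /= in_itv.
exists ((p.2 - y) * c - (p.1 - x) * d); first by rewrite /= in_itv.
case: p {ha hb} => p q /=; congr pair.
- transitivity (x + (p - x) * (c ^+ 2 + d ^+ 2)); first by ring.
  by rewrite u; ring.
- transitivity (y + (q - y) * (c ^+ 2 + d ^+ 2)); first by ring.
  by rewrite u; ring.
Qed.

(** Turning the direction by a quarter turn and moving to the corresponding
    corner describes the same square; up to three such turns bring the
    direction into the required quadrant. *)
Lemma square_frame {R : realType} (Q : square R) :
  exists x y c d, is_frame (square_set Q) (side Q) x y c d.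
Proof.
have := square_set_coords Q.
move: (square_set Q) => S.
case: Q => -[x y] [c d] s /= u s0 memS.
have [[c0 d0]|[[c0 d0]|[[c0 d0]|[c0 d0]]]] :
    (0 < c /\ 0 <= d) \/ (c <= 0 /\ 0 < d) \/ (0 <= c /\ d < 0) \/
    (c < 0 /\ d <= 0).
  have [d0|d0|d0] := ltgtP d 0; have [c0|c0|c0] := ltgtP c 0; try lra.
  by move: u; rewrite d0 c0; lra.
- by exists x, y, c, d; split.
- exists (x - s * d), (y + s * c), d, (- c); split; [lra|lra|lra|].
  move=> p; rewrite memS.
  have -> : (p.1 - (x - s * d)) * d + (p.2 - (y + s * c)) * - c =
     s * (c ^+ 2 + d ^+ 2) - ((p.2 - y) * c - (p.1 - x) * d) by ring.
  have -> : (p.2 - (y + s * c)) * d - (p.1 - (x - s * d)) * - c =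
     (p.1 - x) * c + (p.2 - y) * d by ring.
  by rewrite u mulr1; split; lra.
- exists (x + s * c), (y + s * d), (- d), c; split; [lra|lra|lra|].
  move=> p; rewrite memS.
  have -> : (p.1 - (x + s * c)) * - d + (p.2 - (y + s * d)) * c =
     (p.2 - y) * c - (p.1 - x) * d by ring.
  have -> : (p.2 - (y + s * d)) * - d - (p.1 - (x + s * c)) * c =
     s * (c ^+ 2 + d ^+ 2) - ((p.1 - x) * c + (p.2 - y) * d) by ring.
  by rewrite u mulr1; split; lra.
- exists (x + s * c - s * d), (y + s * d + s * c), (- c), (- d).
  split; [lra|lra|lra|].
  move=> p; rewrite memS.
  have -> : (p.1 - (x + s * c - s * d)) * - c +
      (p.2 - (y + s * d + s * c)) * - d =
     s * (c ^+ 2 + d ^+ 2) - ((p.1 - x) * c + (p.2 - y) * d) by ring.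
  have -> : (p.2 - (y + s * d + s * c)) * - c -
      (p.1 - (x + s * c - s * d)) * - d =
     s * (c ^+ 2 + d ^+ 2) - ((p.2 - y) * c - (p.1 - x) * d) by ring.
  by rewrite u mulr1; split; lra.
Qed.

Lemma frame_nbhs {R : realType} {S : set (R * R)} {s x y c d : R}
    (hS : is_frame S s x y c d) (p : R * R) :
  0 < (p.1 - x) * c + (p.2 - y) * d < s ->
  0 < (p.2 - y) * c - (p.1 - x) * d < s ->
  interior S p.
Proof.
move=> /andP[a0 a1] /andP[b0 b1].
have contx : (q.1 - x) @[q --> p] --> p.1 - x.
  by apply: cvgB; [exact: cvg_fst|exact: cvg_cst].
have conty : (q.2 - y) @[q --> p] --> p.2 - y.
  by apply: cvgB; [exact: cvg_snd|exact: cvg_cst].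
have conta : ((q.1 - x) * c + (q.2 - y) * d) @[q --> p]
    --> (p.1 - x) * c + (p.2 - y) * d.
  by apply: cvgD; apply: cvgMl.
have contb : ((q.2 - y) * c - (q.1 - x) * d) @[q --> p]
    --> (p.2 - y) * c - (p.1 - x) * d.
  by apply: cvgB; apply: cvgMl.
rewrite /interior /=; near=> q; apply/(frame_mem hS); split.
- apply/andP; split; apply: ltW; near: q.
  + exact: (cvgr_gt _ conta).
  + exact: (cvgr_lt _ conta).
- apply/andP; split; apply: ltW; near: q.
  + exact: (cvgr_gt _ contb).
  + exact: (cvgr_lt _ contb).
Unshelve. all: by end_near. Qed.

Lemma near0_affine_lt {R : realType} (u k a : R) :
  u < a -> \forall e \near 0^'+, u + e * k < a.
Proof.
move=> ua.
have cont : u + e * k @[e --> 0^'+] --> u.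
  have {2}-> : u = u + 0 * k by rewrite mul0r addr0.
  apply: cvg_at_right_filter.
  by apply: cvgD; [exact: cvg_cst|apply: cvgMl; exact: cvg_id].
exact: (cvgr_lt _ cont).
Qed.

(** A point outside a square violates one of four affine inequalities strictly,
    and still does so after a short move. *)
Lemma frame_ray_escape {R : realType} {S : set (R * R)} {s x y c d : R}
    (hS : is_frame S s x y c d) (v w : R * R) :
  ~ S v -> \forall e \near 0^'+, ~ S (v.1 + e * w.1, v.2 + e * w.2).
Proof.
rewrite (frame_mem hS) => notSv.
set a := (v.1 - x) * c + (v.2 - y) * d in notSv.
set b := (v.2 - y) * c - (v.1 - x) * d in notSv.
set al := w.1 * c + w.2 * d; set be := w.2 * c - w.1 * d.
suff: \forall e \near 0^'+, ~ (0 <= a + e * al <= s /\ 0 <= b + e * be <= s).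
  apply: filterS => e + /(frame_mem hS)/= he; apply.
  by move: he; rewrite /a /b /al /be; split; lra.
have [a0|a0] := ltP a 0.
  by apply: filterS (near0_affine_lt a al 0 a0) => e; lra.
have [b0|b0] := ltP b 0.
  by apply: filterS (near0_affine_lt b be 0 b0) => e; lra.
have [a1|a1] := ltP s a.
  have lt : - a < - s by lra.
  by apply: filterS (near0_affine_lt (- a) (- al) (- s) lt) => e; lra.
have lt : - b < - s.
  by have [//|b1] := ltP (- b) (- s); case: notSv; lra.
by apply: filterS (near0_affine_lt (- b) (- be) (- s) lt) => e; lra.
Qed.

(** * No tile is tilted *)

(** The displayed direction is (c, d) + (c / 2) (- d, c): it leaves the corner
    strictly inside the square, while its first coordinate is still
    positive. *)
Lemma tilted_interior {R : realType} {S : set (R * R)} {s x y c d : R}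
    (hS : is_frame S s x y c d) (t : R) : 0 < d -> 0 < t -> t < s ->
  interior S (x + t * (c - c * d / 2), y + t * (d + c ^+ 2 / 2)).
Proof.
case: (hS) => c0 _ u _ d0 t0 ts; apply: (frame_nbhs hS) => /=.
- have -> : (x + t * (c - c * d / 2) - x) * c + (y + t * (d + c ^+ 2 / 2) - y) * d
    = t * (c ^+ 2 + d ^+ 2) by field.
  by rewrite u; lra.
- have -> : (y + t * (d + c ^+ 2 / 2) - y) * c - (x + t * (c - c * d / 2) - x) * d
    = t * (c / 2) * (c ^+ 2 + d ^+ 2) by field.
  by rewrite u; nra.
Qed.

(** An upright square containing the corner (x, y) and a point further up and
    to the right contains the whole box between them, and the tilted square
    enters the interior of that box. *)
Lemma tilted_upright_overlap {R : realType} {S S' : set (R * R)}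
    {s x y c d s' x' y' : R} (e : R) :
  is_frame S s x y c d -> is_frame S' s' x' y' 1 0 ->
  0 < d -> 0 < e -> e < s / 2 ->
  S' (x, y) -> S' (x + e * (2 * c), y + e * d) ->
  exists p, interior S p /\ interior S' p.
Proof.
move=> hS hS' d0 e0 es Sv Sw; have [c0 _ u _] := hS.
have c1 : c < 1 by nra.
have d1 : d < 1 by nra.
have t0 : 0 < e * d / 2 by nra.
have ts : e * d / 2 < s by nra.
exists (x + e * d / 2 * (c - c * d / 2), y + e * d / 2 * (d + c ^+ 2 / 2)).
split; first exact: tilted_interior hS _ d0 t0 ts.
move: Sv Sw; rewrite !(frame_mem hS') /= !(mulr1, mulr0, addr0, subr0).
move=> Sv Sw.
have ed0 : 0 < e * d by rewrite mulr_gt0.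
have [dd0 dd1] : 0 < e * d * d /\ e * d * d < e * d.
  by split; [rewrite mulr_gt0|rewrite gtr_pMr].
have [cd0 cd1] : 0 < e * d * c /\ e * d * c < e * d.
  by split; [rewrite mulr_gt0|rewrite gtr_pMr].
have [ccd0 ccd1] : 0 < e * d * c * c /\ e * d * c * c < e * d * c.
  by split; [rewrite mulr_gt0|rewrite gtr_pMr].
have [cdd0 cdd1] : 0 < e * d * c * d /\ e * d * c * d < e * d * c.
  by split; [rewrite mulr_gt0|rewrite gtr_pMr].
have cde : e * c * d < e * c by rewrite gtr_pMr// mulr_gt0.
by apply: (frame_nbhs hS') => /=; rewrite !(mulr1, mulr0, addr0, subr0); lra.
Qed.

(** The slope hypothesis places the lower edge of the first square inside the
    right angle that the second one spans at their common corner. *)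
Lemma tilted_tilted_overlap {R : realType} {S S' : set (R * R)}
    {s s' x y c d c' d' : R} :
  is_frame S s x y c d -> is_frame S' s' x y c' d' ->
  0 < s -> 0 < s' -> 0 < d -> 0 < d' -> c * d' < d * c' ->
  exists p, interior S p /\ interior S' p.
Proof.
move=> hS hS' s0 s'0 d0 d'0 slope.
have [c0 _ u _] := hS; have [c'0 _ u' _] := hS'.
have [t [t0 ti tj]] : exists t, [/\ 0 < t, t < s & t < s' / 3].
  have m0 : 0 < Num.min s (s' / 3) by rewrite lt_min s0 divr_gt0.
  have ms : Num.min s (s' / 3) <= s by rewrite ge_min lexx.
  have ms' : Num.min s (s' / 3) <= s' / 3 by rewrite ge_min lexx orbT.
  by exists (Num.min s (s' / 3) / 2); split; lra.
exists (x + t * (c - c * d / 2), y + t * (d + c ^+ 2 / 2)).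
split; first exact: tilted_interior hS _ d0 t0 ti.
clear hS; have c1 : c < 1 by nra.
have d1 : d < 1 by nra.
have c'1 : c' < 1 by nra.
have d'1 : d' < 1 by nra.
apply: (frame_nbhs hS') => /=; clear hS' u u' ti.
- have -> : (x + t * (c - c * d / 2) - x) * c' +
      (y + t * (d + c ^+ 2 / 2) - y) * d'
    = t * ((c - c * d / 2) * c' + (d + c ^+ 2 / 2) * d') by ring.
  have A0 : 0 < c - c * d / 2 by nra.
  have A1 : c - c * d / 2 < 1 by nra.
  have B0 : 0 < d + c ^+ 2 / 2 by nra.
  have B1 : d + c ^+ 2 / 2 < 2 by nra.
  move: (c - _) (d + _) A0 A1 B0 B1 => A B A0 A1 B0 B1.
  have [AB0 AB1] : 0 < A * c' + B * d' /\ A * c' + B * d' < 3.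
    by split; nra.
  by rewrite mulr_gt0//=; nra.
- have -> : (y + t * (d + c ^+ 2 / 2) - y) * c' -
      (x + t * (c - c * d / 2) - x) * d'
    = t * ((d * c' - c * d') + c / 2 * (d * d' + c * c')) by field.
  have q0 : 0 < c / 2 * (d * d' + c * c').
    by rewrite mulr_gt0 ?divr_gt0// addr_gt0// mulr_gt0.
  have cd0 : 0 < c * d' by rewrite mulr_gt0.
  have r1 : d * c' < 1 by nra.
  have r2 : d * d' + c * c' < 2 by nra.
  have r3 : c / 2 * (d * d' + c * c') < 1 by nra.
  have [] : 0 < d * c' - c * d' + c / 2 * (d * d' + c * c') /\
    d * c' - c * d' + c / 2 * (d * d' + c * c') < 3 by lra.
  by move: (_ + _) => A A0 A1; rewrite mulr_gt0//=; nra.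
Qed.

(** A tilted tile with lowest possible corner would leave, just below its lower
    edge, a wedge that no tile can cover without overlapping it. *)
Lemma tiles_axis_parallel {R : realType} (n : nat)
    (S : 'I_n -> set (R * R)) (s x y c d : 'I_n -> R)
    (s0 : forall i, 0 < s i)
    (hS : forall i, is_frame (S i) (s i) (x i) (y i) (c i) (d i))
    (disj : forall i j, i != j -> interior (S i) `&` interior (S j) = set0)
    (cover : \bigcup_(i in [set: 'I_n]) S i = unit_square R) :
  forall i, d i = 0.
Proof.
move=> i0; apply/eqP; apply: contraT => di0.
have d0 : 0 < d i0 by rewrite lt_def di0 (frame_d (hS i0)).
pose i := [arg min_(i < i0 | 0 < d i) y i]%O.
have [di ymin] : 0 < d i /\ forall j, 0 < d j -> y i <= y j.
  by rewrite /i; case: arg_minP.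
have [ci _ ui _] := hS i.
have memS j p := frame_mem (hS j) p.
have disj' j p : j != i -> interior (S i) p -> interior (S j) p -> False.
  move=> ji pi pj; have := disj i j; rewrite eq_sym ji => /(_ isT).
  by move=> /seteqP[/(_ p) + _]; apply.
have c1 : c i < 1 by nra.
have d1 : d i < 1 by nra.
have Sunit j p : S j p -> (0 <= p.1 <= 1) /\ (0 <= p.2 <= 1).
  move=> Sp; have : unit_square R p by rewrite -cover; exists j.
  by rewrite /unit_square /= !in_itv /=.
have si := s0 i.
have Sv : S i (x i, y i).
  by apply/memS => /=; rewrite !subrr !mul0r addr0 subr0; lra.
have Sv' : S i (x i + s i * c i, y i + s i * d i).
  apply/memS => /=.
  have -> : (x i + s i * c i - x i) * c i + (y i + s i * d i - y i) * d i
     = s i * (c i ^+ 2 + d i ^+ 2) by ring.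
  have -> : (y i + s i * d i - y i) * c i - (x i + s i * c i - x i) * d i
     = 0 by ring.
  by rewrite ui mulr1; lra.
have [/= /andP[x0 _] /andP[y0 _]] := Sunit _ _ Sv.
have [/= /andP[_ x1] /andP[_ y1]] := Sunit _ _ Sv'.
(* The direction w has half the slope of the lower edge (c, d) of tile i, so it
   points into the wedge below that edge. *)
pose w : R * R := (2 * c i, d i).
have : \forall e \near 0^'+,
    forall j, ~ S j (x i, y i) -> ~ S j (x i + e * w.1, y i + e * w.2).
  apply: filter_forall => j.
  have [Sj|nSj] := pselect (S j (x i, y i)).
    by apply: filterE => e /(_ Sj).
  apply: filterS (frame_ray_escape (hS j) (x i, y i) w nSj) => e /=.
  by move=> + _.
move=> far.
(* A tile containing the point at a small distance e along w contains the
   corner too; for e < s i / 2 that point is still in the unit square. *)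
have [e [e0 es efar]] : exists e, [/\ 0 < e, e < s i / 2 &
    forall j, ~ S j (x i, y i) -> ~ S j (x i + e * w.1, y i + e * w.2)].
  have : \forall e \near 0^'+, [/\ 0 < e, e < s i / 2 &
    forall j, ~ S j (x i, y i) -> ~ S j (x i + e * w.1, y i + e * w.2)].
    near=> e; split; near: e => //.
    - exact: nbhs_right_gt.
    - by apply: nbhs_right_lt; lra.
  by move=> /filter_ex.
have {far} [j Sjw] : exists j, S j (x i + e * w.1, y i + e * w.2).
  have : unit_square R (x i + e * w.1, y i + e * w.2).
    by rewrite /unit_square /= !in_itv /= /w /=; split; nra.
  by rewrite -cover => -[j _]; exists j.
have Sjv : S j (x i, y i) by apply: contrapT => /efar.
have ji : j != i.
  apply/eqP => ji; move: Sjw; rewrite ji memS /w /= => -[_ /andP[+ _]].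
  have -> : (y i + e * d i - y i) * c i - (x i + e * (2 * c i) - x i) * d i =
     - (e * (c i * d i)) by ring.
  by rewrite oppr_ge0 leNgt !mulr_gt0.
have [cj dj uj _] := hS j.
have sj := s0 j.
have [dj0|dj0] := leP (d j) 0.
  have {}dj0 : d j = 0 by lra.
  have cj1 : c j = 1.
    by move: uj; rewrite dj0 expr0n addr0 => /eqP; rewrite sqrf_eq1;
      move=> /orP[]/eqP; lra.
  have := hS j; rewrite cj1 dj0 => hSj.
  have [p [Sip Sjp]] := tilted_upright_overlap e (hS i) hSj di e0 es Sjv Sjw.
  by case: (disj' j p ji Sip Sjp).
(* A tilted tile j through the corner of i starts no lower than i, and it has
   no other point at the height of its own corner. *)
have [xij yij] : x j = x i /\ y j = y i.
  move: (Sjv) (ymin j dj0); rewrite memS /=.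
  set a := (_ * _ + _); set b := (_ - _) => -[/andP[a0 _] /andP[b0 _]] yij.
  have yE : y i - y j = a * d j + b * c j.
    transitivity ((y i - y j) * (c j ^+ 2 + d j ^+ 2)).
      by rewrite uj mulr1.
    by rewrite /a /b; ring.
  have ad0 : 0 <= a * d j by rewrite mulr_ge0.
  have bc0 : 0 <= b * c j by rewrite mulr_ge0// ltW.
  have yij' : y j = y i by lra.
  have az : a = 0.
    have : a * d j == 0 by apply/eqP; lra.
    by rewrite mulf_eq0 => /orP[/eqP//|/eqP]; lra.
  split=> //; move: az; rewrite /a yij' subrr mul0r addr0 => /eqP.
  by rewrite mulf_eq0 => /orP[/eqP|/eqP]; lra.
move: Sjw; rewrite memS /w /= xij yij => -[_ /andP[+ _]].
have -> : (y i + e * d i - y i) * c j - (x i + e * (2 * c i) - x i) * d j =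
  e * (d i * c j - 2 * (c i * d j)) by ring.
rewrite pmulr_rge0// => slope.
have cd0 : 0 < c i * d j by rewrite mulr_gt0.
have := hS j; rewrite xij yij => hSj.
have [|p [Sip Sjp]] := tilted_tilted_overlap (hS i) hSj si sj di dj0; first lra.
by case: (disj' j p ji Sip Sjp).
Unshelve. all: by end_near. Qed.

(** * Measuring a dissection *)

(** The B i are the open parts of the tiles A i: disjointness of the B i bounds
    the sum by the measure of D, and subadditivity on the A i bounds it from
    below.  The predicate P serves to select the tiles met by a line. *)
Lemma measure_almost_partition {R : realType} {disp : measure_display}
    {X : measurableType disp} (mu : {measure set X -> \bar R}) {n : nat}
    (P : pred 'I_n) (A B : 'I_n -> set X) (D : set X) :
  (forall i, P i -> measurable (A i)) -> (forall i, P i -> measurable (B i)) ->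
  (forall i, P i -> B i `<=` A i) -> (forall i, P i -> mu (A i) = mu (B i)) ->
  trivIset P B -> measurable D ->
  (forall i, P i -> A i `<=` D) ->
  D `<=` \bigcup_(i in P) A i ->
  (\sum_(i < n | P i) mu (A i))%E = mu D.
Proof.
move=> mA mB BA muAB tB mD AD DA; apply/eqP; rewrite eq_le; apply/andP; split.
- rewrite (eq_bigr (fun i => mu (B i)))//.
  rewrite -measure_bigsetU_ord_cond//.
  have mU : measurable (\big[setU/set0]_(i < n | P i) B i).
    by apply: bigsetU_measurable => i /mB.
  apply: le_measure; rewrite ?inE// => p.
  by rewrite -bigcup_seq_cond => -[i /andP[_ Pi]] /(BA i Pi) /(AD i Pi).
- pose U := \big[setU/set0]_(i < n | P i) A i.
  have mU : measurable U by apply: bigsetU_measurable => i /mA.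
  apply: (@le_trans _ _ (mu U)).
    apply: le_measure; rewrite ?inE// => p /DA[i Pi Ap].
    by rewrite /U -bigcup_seq_cond; exists i => //=; rewrite mem_index_enum.
  suff [] : measurable U /\ (mu U <= \sum_(i < n | P i) mu (A i))%E by [].
  rewrite {mU}/U; elim/big_rec2: _ => [|i a b Pi [mb ba]].
    by rewrite measure0.
  split; first by apply: measurableU => //; exact: mA.
  apply: le_trans (measureU2 mu (mA i Pi) mb) _.
  by rewrite leeD2l.
Qed.

(** * Upright tilings *)

(** A tiling of the unit square by the boxes with lower left corners (x i, y i)
    and sides s i, expressed by coordinates. *)
Record upright {R : realType} {n : nat} (s x y : 'I_n -> R) : Prop := Upright {
  upright_gt0 : forall i, 0 < s i;
  upright_cover : forall u v, (0 <= u <= 1 /\ 0 <= v <= 1) <->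
    exists i, x i <= u <= x i + s i /\ y i <= v <= y i + s i;
  upright_disj : forall i j, i != j -> forall u v,
    x i < u < x i + s i -> y i < v < y i + s i ->
    x j < u < x j + s j -> y j < v < y j + s j -> False }.

Arguments upright_gt0 {R n s x y}.
Arguments upright_cover {R n s x y}.
Arguments upright_disj {R n s x y}.

Lemma tiling_upright {R : realType} {n : nat} (T : 'I_n -> square R) :
  is_tiling T -> exists x y, upright (fun i => side (T i)) x y.
Proof.
case=> disj cover.
have /choice[f hf] : forall i, exists f : (R * R) * (R * R),
    is_frame (square_set (T i)) (side (T i)) f.1.1 f.1.2 f.2.1 f.2.2.
  move=> i; have [x [y [c [d h]]]] := square_frame (T i).
  by exists ((x, y), (c, d)).
have d0 := tiles_axis_parallel _ _ _ _ _ _ _ (fun i => side_gt0 (T i)) hf disj cover.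
have {}hf i : is_frame (square_set (T i)) (side (T i)) (f i).1.1 (f i).1.2 1 0.
  have := hf i; rewrite d0 => h; have := frame_unit h.
  rewrite expr0n addr0 => /eqP; rewrite sqrf_eq1 => /orP[]/eqP c1.
    by rewrite c1 in h.
  by have := frame_c h; rewrite c1; lra.
exists (fun i => (f i).1.1), (fun i => (f i).1.2); split.
- by move=> i; exact: side_gt0.
- move=> u v; have -> : (0 <= u <= 1 /\ 0 <= v <= 1) <-> unit_square R (u, v).
    by rewrite /unit_square /= !in_itv.
  rewrite -cover; split.
    case=> i _; rewrite (frame_mem (hf i)) /= !(mulr1, mulr0, addr0, subr0).
    by move=> h; exists i; lra.
  case=> i h; exists i => //.
  by rewrite (frame_mem (hf i)) /= !(mulr1, mulr0, addr0, subr0); lra.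
- move=> i j ij u v xi yi xj yj.
  have := disj i j ij => /seteqP[/(_ (u, v)) + _]; apply; split.
  + by apply: (frame_nbhs (hf i)) => /=; rewrite !(mulr1, mulr0, addr0, subr0);
      lra.
  + by apply: (frame_nbhs (hf j)) => /=; rewrite !(mulr1, mulr0, addr0, subr0);
      lra.
Qed.

Lemma lebesgue_measure_itvcc {R : realType} (a s : R) : 0 < s ->
  lebesgue_measure `[a, a + s] = s%:E.
Proof.
by move=> s0; rewrite lebesgue_measure_itv /= lte_fin ltrDl s0 -EFinB addrC addKr.
Qed.

Lemma lebesgue_measure_itvoo {R : realType} (a s : R) : 0 < s ->
  lebesgue_measure `]a, a + s[ = s%:E.
Proof.
by move=> s0; rewrite lebesgue_measure_itv /= lte_fin ltrDl s0 -EFinB addrC addKr.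
Qed.

Lemma upright_area {R : realType} {n : nat} {s x y : 'I_n -> R} :
  upright s x y -> \sum_i s i ^+ 2 = 1.
Proof.
move=> h; have s0 := upright_gt0 h.
pose mu := (lebesgue_measure \x lebesgue_measure)%E : set (R * R) -> \bar R.
pose A i : set (R * R) := `[x i, x i + s i] `*` `[y i, y i + s i].
pose B i : set (R * R) := `]x i, x i + s i[ `*` `]y i, y i + s i[.
have muA i : mu (A i) = (s i ^+ 2)%:E.
  rewrite /mu /A product_measure1E// expr2 EFinM.
  by congr (_ * _)%E; exact: lebesgue_measure_itvcc.
have muB i : mu (B i) = (s i ^+ 2)%:E.
  rewrite /mu /B product_measure1E// expr2 EFinM.
  by congr (_ * _)%E; exact: lebesgue_measure_itvoo.
have mu1 : mu (`[0, 1] `*` `[0, 1]) = 1%:E.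
  have h1 := lebesgue_measure_itvcc (0 : R) 1 ltr01; rewrite add0r in h1.
  rewrite /mu product_measure1E// -[1%:E]mule1.
  by congr (_ * _)%E; exact: h1.
apply: EFin_inj; rewrite -mu1 -sumEFin (eq_bigr (fun i => mu (A i))); last first.
  by move=> i _; exact: esym (muA i).
apply: (measure_almost_partition (lebesgue_measure \x lebesgue_measure)%E
  predT A B).
- by move=> i _; apply: measurableX.
- by move=> i _; apply: measurableX.
- move=> i _ [u v]; rewrite /A /B /= !in_itv /=; lra.
- by move=> i _; exact: etrans (muA i) (esym (muB i)).
- move=> i j _ _ [[u v]]; rewrite /B /= !in_itv /= => -[[xi yi] [xj yj]].
  apply/eqP/contraT => ij.
  by case: (upright_disj h i j ij u v).
- exact: measurableX.
- move=> i _ [u v]; rewrite /A /= !in_itv /= => uv.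
  by apply/(upright_cover h); exists i.
- move=> [u v]; rewrite /= !in_itv /= => /(upright_cover h)[i uv].
  by exists i => //; rewrite /A /= !in_itv.
Qed.

(** The line at height v contains no horizontal edge, so the tiles that it meets
    cut it into closed intervals with disjoint interiors. *)
Lemma upright_line {R : realType} {n : nat} {s x y : 'I_n -> R} (v : R) :
  upright s x y -> 0 <= v <= 1 ->
  (forall i, v != y i) -> (forall i, v != y i + s i) ->
  \sum_(i | y i < v < y i + s i) s i = 1.
Proof.
move=> h v01 vy vys; have s0 := upright_gt0 h.
pose A i : set R := `[x i, x i + s i]%classic.
pose B i : set R := `]x i, x i + s i[%classic.
have muA i : lebesgue_measure (A i) = (s i)%:E.
  exact: lebesgue_measure_itvcc.
have muB i : lebesgue_measure (B i) = (s i)%:E.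
  exact: lebesgue_measure_itvoo.
have mu1 : lebesgue_measure (`[0, 1]%classic : set R) = 1%:E.
  by have := lebesgue_measure_itvcc (0 : R) 1 ltr01; rewrite add0r.
apply: EFin_inj; rewrite -mu1 -sumEFin.
rewrite (eq_bigr (fun i => lebesgue_measure (A i))); last first.
  by move=> i _; exact: esym (muA i).
apply: (measure_almost_partition lebesgue_measure
  (fun i => y i < v < y i + s i) A B).
- by move=> i _; apply: measurable_itv.
- by move=> i _; apply: measurable_itv.
- move=> i _ u; rewrite /A /B /= !in_itv /=; lra.
- by move=> i _; exact: etrans (muA i) (esym (muB i)).
- move=> i j yi yj [u]; rewrite /B /= !in_itv /= => -[xi xj].
  apply/eqP/contraT => ij.
  by case: (upright_disj h i j ij u v).
- exact: measurable_itv.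
- move=> i yi u; rewrite /A /= !in_itv /= => xi.
  by have [] : 0 <= u <= 1 /\ 0 <= v <= 1 by
    apply/(upright_cover h); exists i; split => //; lra.
- move=> u; rewrite /= !in_itv /= => u01.
  have /(upright_cover h)[i [xi /andP[yi1 yi2]]] := conj u01 v01.
  exists i; last by rewrite /A /= in_itv.
  by rewrite !lt_neqAle yi1 yi2 vys eq_sym vy.
Qed.

(** Only finitely many heights carry a horizontal edge. *)
Lemma upright_line_right {R : realType} {n : nat} {s x y : 'I_n -> R} (c : R) :
  upright s x y -> 0 <= c < 1 ->
  \forall v \near c^'+, \sum_(i | y i < v < y i + s i) s i = 1.
Proof.
move=> h /andP[c0 c1].
have avoid (a : R) : \forall v \near c^'+, v != a.
  have [ca|ac] := ltP c a.
    have := nbhs_right_lt ca; by apply: filterS => v va; rewrite lt_eqF.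
  near=> v; rewrite gt_eqF//; apply: le_lt_trans ac _; near: v.
  exact: nbhs_right_gt.
near=> v; apply: (upright_line v h).
- apply/andP; split; near: v; last exact: nbhs_right_le.
  have := nbhs_right_gt c; apply: filterS => v cv.
  by apply: ltW; exact: le_lt_trans cv.
- by near: v; apply: filter_forall => i.
- by near: v; apply: filter_forall => i.
Unshelve. all: by end_near. Qed.

Lemma upright_inside {R : realType} {n : nat} {s x y : 'I_n -> R} (i : 'I_n) :
  upright s x y -> 0 <= y i /\ y i + s i <= 1.
Proof.
move=> h; have s0 := upright_gt0 h i.
have [_ lo] : 0 <= x i <= 1 /\ 0 <= y i <= 1.
  by apply/(upright_cover h); exists i; rewrite !lexx !lerDl !ltW.
have [_ hi] : 0 <= x i <= 1 /\ 0 <= y i + s i <= 1.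
  by apply/(upright_cover h); exists i; rewrite !lexx !lerDl !ltW.
by split; lra.
Qed.

(** A tile of side less than 1 leaves room below or above it; a line just above
    the bottom of the unit square, or just above the top of the tile, misses
    it. *)
Lemma upright_line_missing {R : realType} {n : nat} {s x y : 'I_n -> R}
    (i : 'I_n) : upright s x y -> s i < 1 ->
  exists2 v, ~~ (y i < v < y i + s i) & \sum_(j | y j < v < y j + s j) s j = 1.
Proof.
move=> h si1; have s0 := upright_gt0 h i; have [yi0 yi1] := upright_inside i h.
have [yi|yi] := ltP 0 (y i).
- have : \forall v \near 0^'+, ~~ (y i < v < y i + s i) /\
      \sum_(j | y j < v < y j + s j) s j = 1.
    near=> v; split; last by near: v; apply: (upright_line_right _ h); lra.
    rewrite negb_and -leNgt; apply/orP; left; near: v; exact: nbhs_right_le.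
  by move=> /filter_ex[v []]; exists v.
- have : \forall v \near (y i + s i)^'+, ~~ (y i < v < y i + s i) /\
      \sum_(j | y j < v < y j + s j) s j = 1.
    near=> v; split; last by near: v; apply: (upright_line_right _ h); lra.
    rewrite negb_and -!leNgt; apply/orP; right; near: v; exact: nbhs_right_ge.
  by move=> /filter_ex[v []]; exists v.
Unshelve. all: by end_near. Qed.

(** * Two minimal tiles *)

Lemma pair_le_sum {n : nat} (F : 'I_n -> int) (i j : 'I_n) :
  (forall l, 0 <= F l) -> i != j -> F i + F j <= \sum_l F l.
Proof.
move=> F0 ij; rewrite (bigD1 i)//= (bigD1 j) 1?eq_sym//= lerD2l lerDl.
exact: sumr_ge0.
Qed.

(** Put L = sum m_l and suppose N(k^2+1) < kL.  With N = tk + r and 1 <= r <= k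
    this says k(L - Nk) >= N + 1 = tk + r + 1, so L >= Nk + t + 1, and
    L >= Nk + t + 2 if r = k.  On the other hand
    N^2 - (2t+1)L + t(t+1)(k^2+3) = sum_l (m_l - t)(m_l - t - 1) >= 2t(t-1).
    Inserting the lower bound for L leaves (t-1)^2 <= - r(k-r) if r < k, and
    (t-1)^2 <= - (2t+1) if r = k; both are absurd. *)
Lemma two_units_short (k N : nat) (m : 'I_(k ^ 2 + 3) -> nat)
    (i j : 'I_(k ^ 2 + 3)) (k0 : (0 < k)%N) :
  i != j -> m i = 1%N -> m j = 1%N -> (0 < N)%N ->
  (\sum_l m l ^ 2 = N ^ 2)%N ->
  (k * (\sum_l m l) <= N * (k ^ 2 + 1))%N.
Proof.
move=> ij mi mj N0 area; rewrite leqNgt; apply/negP => long.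
have [t [r [NE r0 rk]]] : exists t r, [/\ N = t * k + r, 0 < r & r <= k]%N.
  (* Dividing N - 1 instead of N makes the remainder r range over 1..k. *)
  exists (N.-1 %/ k)%N, (N.-1 %% k).+1; split=> //; last exact: ltn_pmod.
  by rewrite addnS -divn_eq prednK.
set L := (\sum_l m l)%N in long *.
have Fge0 (l : 'I_(k ^ 2 + 3)) :
    0 <= ((m l)%:Z - t%:Z) * ((m l)%:Z - t%:Z - 1).
  have [h|h] := leqP (m l) t; nia.
have := pair_le_sum _ _ _ Fge0 ij; rewrite mi mj.
have -> : \sum_l ((m l)%:Z - t%:Z) * ((m l)%:Z - t%:Z - 1) =
    (N ^ 2)%:Z - (2 * t%:Z + 1) * L%:Z + (t * t.+1 * (k ^ 2 + 3))%:Z.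
  under eq_bigr => l _.
    have -> : ((m l)%:Z - t%:Z) * ((m l)%:Z - t%:Z - 1) =
      (m l ^ 2)%:Z - (2 * t%:Z + 1) * (m l)%:Z + (t * t.+1)%:Z by lia.
    over.
  rewrite big_split/= big_split/= sumrN -mulr_sumr sumr_const card_ord.
  rewrite -area /L -!(big_morph Posz PoszD (erefl 0%:Z)).
  by congr (_ + _); rewrite -mulr_natr natz -PoszM.
move=> sumge.
have bound (u : nat) : (N * k + t + u <= L)%N ->
    2 * t%:Z * (t%:Z - 1) <= (N ^ 2)%:Z
      - (2 * t%:Z + 1) * (N * k + t + u)%:Z + (t * t.+1 * (k ^ 2 + 3))%:Z.
  move=> Lge; have : (2 * t%:Z + 1) * (N * k + t + u)%:Z <= (2 * t%:Z + 1) * L%:Z.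
    by rewrite ler_wpM2l//; lia.
  by move: sumge; lia.
have [rk'|rk'] := eqVneq r k.
  have /bound : (N * k + t + 2 <= L)%N.
    rewrite leqNgt; apply/negP => Llt.
    have : (k * L <= k * (N * k + t + 1))%N by rewrite leq_mul2l; lia.
    by move: long; rewrite NE; nia.
  have -> : (N ^ 2)%:Z - (2 * t%:Z + 1) * (N * k + t + 2)%:Z +
      (t * t.+1 * (k ^ 2 + 3))%:Z = (t ^ 2)%:Z - 2 * t%:Z - 2.
    by rewrite NE rk'; lia.
  by nia.
have /bound : (N * k + t + 1 <= L)%N.
  rewrite leqNgt; apply/negP => Llt.
  have : (k * L <= k * (N * k + t))%N by rewrite leq_mul2l; lia.
  by move: long; rewrite NE; nia.
have -> : (N ^ 2)%:Z - (2 * t%:Z + 1) * (N * k + t + 1)%:Z +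
    (t * t.+1 * (k ^ 2 + 3))%:Z = (t ^ 2)%:Z - 1 - r%:Z * (k%:Z - r%:Z).
  by rewrite NE; lia.
have : 1 <= r%:Z * (k%:Z - r%:Z) by nia.
by nia.
Qed.

(** * The theorem *)

Theorem mainTheorem1 (R : realType) (k : nat) (hk : (2 <= k)%N)
    (T : 'I_(k ^ 2 + 3) -> square R)
    (hT : is_tiling T) (hMTP : MTP T)
    (hlen : k%:R + 1 / k%:R < tiling_length T) :
  (3 <= size (side_lengths T))%N /\
  (exists! i : 'I_(k ^ 2 + 3), smallest_tile T i).
Proof.
have [x [y h]] := tiling_upright T hT.
have [i0 i0min] : exists i, smallest_tile T i.
  have n0 : (0 < k ^ 2 + 3)%N by rewrite addn3.
  pose i := [arg min_(i < Ordinal n0) side (T i)]%O.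
  by exists i => j; rewrite /i; case: arg_minP => // l _; apply.
have s0 := side_gt0 (T i0); set s := side (T i0) in s0.
have /choice[m mE] : forall j, exists m : nat,
    (0 < m)%N /\ side (T j) = m%:R * s.
  by move=> j; have [m m0 E] := hMTP i0 j i0min; exists m.
have m0 j : (0 < m j)%N by have [] := mE j.
have {}mE j : side (T j) = (m j)%:R * s by have [] := mE j.
have m_inj i j : side (T i) = side (T j) -> m i = m j.
  rewrite !mE => /mulIf; rewrite gt_eqF// => /(_ isT) /eqP.
  by rewrite eqr_nat => /eqP.
have mi0 : m i0 = 1%N.
  apply/eqP; rewrite -(eqr_nat R); apply/eqP/(mulIf (lt0r_neq0 s0)).
  by rewrite -mE mul1r.
(* Dividing by s turns a horizontal line into a sum of integers. *)
have line (v : R) (P := fun i => y i < v < y i + side (T i)) :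
    \sum_(i | P i) side (T i) = 1 -> (\sum_(i | P i) m i)%:R * s = 1.
  move=> E; rewrite -[RHS]E natr_sum mulr_suml.
  by apply: eq_bigr => i _; rewrite mE.
have [N Ns] : exists N : nat, N%:R * s = 1.
  have lines : 0 <= (0 : R) < 1 by rewrite lexx ltr01.
  have [v vE] := filter_ex (upright_line_right 0 h lines).
  by eexists; exact: line vE.
have N0 : (0 < N)%N.
  by rewrite lt0n; apply: contra_eq_neq Ns => ->; rewrite mul0r eq_sym oner_neq0.
have area : (\sum_j m j ^ 2 = N ^ 2)%N.
  apply/eqP; rewrite -(eqr_nat R); apply/eqP.
  apply: (mulIf (lt0r_neq0 (exprn_gt0 2 s0))).
  rewrite natrX -exprMn Ns expr1n -[RHS](upright_area h) natr_sum mulr_suml.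
  by apply: eq_bigr => j _; rewrite mE exprMn natrX.
have long : (N * (k ^ 2 + 1) < k * \sum_j m j)%N.
  rewrite -(ltr_nat R) !natrM natrD natrX natr_sum -(ltr_pM2r s0).
  have -> : N%:R * (k%:R ^+ 2 + 1) * s = k%:R * (k%:R + 1 / k%:R) :> R.
    have k0 : k%:R != 0 :> R by rewrite pnatr_eq0; lia.
    by rewrite mulrAC Ns; field.
  rewrite -mulrA ltr_pM2l ?ltr0n; last by lia.
  apply: lt_le_trans hlen _; rewrite /tiling_length mulr_suml.
  by apply: ler_sum => j _; rewrite mE.
have uniq_min j : m j = 1%N -> j = i0.
  move=> mj; apply/eqP; apply: contraT => ji0; move: long.
  by rewrite ltnNge (two_units_short _ _ m j i0) //; lia.
split; last first.
  exists i0; split=> // j jmin; apply/esym/uniq_min; rewrite -mi0.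
  by apply: m_inj; apply/eqP; rewrite eq_le jmin i0min.
have [j1 j1i0] : exists j1, j1 != i0.
  have n1 : (1 < k ^ 2 + 3)%N by lia.
  have [E|E] := eqVneq (Ordinal n1) i0; last by exists (Ordinal n1).
  have n0 : (0 < k ^ 2 + 3)%N by lia.
  by exists (Ordinal n0); rewrite -E.
have side_neq j : j != i0 -> side (T j) != s.
  by apply: contra_neq => /m_inj mj; apply: uniq_min; rewrite mj.
have [[j2 [j2i0 j21]]|nj] :=
  pselect (exists j2, j2 != i0 /\ side (T j2) != side (T j1)).
  apply: (@uniq_leq_size _ [:: s; side (T j1); side (T j2)]).
    rewrite /= !inE negb_or andbT ![s == _]eq_sym !side_neq//=.
    by rewrite eq_sym j21.
  have mem j : side (T j) \in side_lengths T.
    by rewrite mem_undup; apply: map_f; rewrite mem_enum.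
  by move=> z; rewrite !inE => /or3P[]/eqP->; exact: mem.
(* From here on all tiles but i0 have the same side. *)
have mj1 j : j != i0 -> m j = m j1.
  move=> ji0; apply: m_inj; apply/eqP; apply: contraT => jj1.
  by case: nj; exists j.
have s1 : s < 1.
  have : s ^+ 2 + side (T j1) ^+ 2 <= 1.
    rewrite -[leRHS](upright_area h) (bigD1 i0)//= (bigD1 j1)//= lerD2l lerDl.
    by apply: sumr_ge0 => j _; exact: sqr_ge0.
  by have := side_gt0 (T j1); nra.
have [v vi0 /line vE] := upright_line_missing i0 h s1.
have [q Nq] : exists q, N = (m j1 * q)%N.
  have /eqP : N%:R * s = (\sum_(i | y i < v < y i + side (T i)) m i)%:R * s.
    by rewrite vE.
  rewrite (inj_eq (mulIf (lt0r_neq0 s0))) eqr_nat => /eqP ->.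
  exists #|[pred i | y i < v < y i + side (T i)]|.
  rewrite mulnC -sum_nat_const; apply: eq_bigr => i iv.
  by apply: mj1; apply: contraNneq vi0 => <-.
have m1 : m j1 != 1%N by apply: contra_neq j1i0; exact: uniq_min.
suff : (m j1 %| 1)%N by rewrite dvdn1 (negbTE m1).
move: area; rewrite (bigD1 i0)//= mi0 => area.
rewrite -(@dvdn_addl (\sum_(i < k ^ 2 + 3 | i != i0) m i ^ 2)%N).
  by rewrite area Nq expnMn dvdn_mulr// dvdn_exp.
by apply: dvdn_sum => i /mj1 ->; apply: dvdn_exp.
Qed.
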